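(* For every integer $d\ge 1$ there is a constant $c_d>0$ depending only on $d$ such that the following holds. Let $P\in\mathbb{Z}[X]$ be a polynomial of degree $d$ with height $\mathrm{H}(P)$, and let $\alpha,\beta\in\mathbb{C}$ be two of its roots such that $|\alpha|\neq|\beta|$. Then: 1. if $\alpha$ and $\beta$ are real, then $\bigl||\alpha|-|\beta|\bigr|\ge c_d\, \mathrm{H}(P)^{-(d-1)}$; 2. if $\alpha$ is real and $\beta$ is not, then $\bigl||\alpha|-|\beta|\bigr|\ge c_d\, \mathrm{H}(P)^{-2(d-1)(d-2)}$; 3. if neither $\alpha$ nor $\beta$ is real, then $\bigl||\alpha|-|\beta|\bigr|\ge c_d\, \mathrm{H}(P)^{-(d-1)(d-2)(d-3)/2}$.
   Context: The height $\mathrm{H}(P)$ of a polynomial $P$ is the maximum of the absolute values of its coefficients. *)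

(* Defs.v *)
From HB Require Import structures.
From mathcomp Require Import all_boot all_order all_algebra.
From mathcomp Require Import reals complex.

Set Implicit Arguments.
Unset Strict Implicit.
Unset Printing Implicit Defensive.

Import Order.TTheory GRing.Theory Num.Theory.
Local Open Scope ring_scope.

Definition height (P : {poly int}) : nat := (\max_(i < size P) `|(P`_i)%R|)%N.

(* Main.v *)
(** Let [x_1, ..., x_d] be the roots of [P], with repetitions, and [a] its leading
    coefficient. Up to positive factors bounded in terms of the roots,
    [|alpha| - |beta|] is one of
    - [x_i + e x_j] with [e = 1] or [-1], if [alpha] and [beta] are real;
    - [x_i ^ 2 - x_j x_l], from [alpha ^ 2 - beta beta^*], if only [alpha] is;
    - [x_i x_j - x_l x_m], from [alpha alpha^* - beta beta^*], if none is,
    where the indices are distinct. Let [T_u] be the values of such a form over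
    all tuples [u] of distinct indices. The coefficients of [\prod_u (X - T_u)]
    are symmetric polynomials in the roots, of the same degree bound [E] in each
    of them, so [a ^ E] times any of them is an integer. For the lowest nonzero
    coefficient this gives [|a| ^ E \prod_(T_u != 0) |T_u| >= 1], whether or not
    [P] is squarefree. On the other side [|T_u|] is at most twice a monomial of
    degree [E] (over all [u]) in each [1 + |x_i|], and [|a| \prod_i (1 + |x_i|)]
    is at most a constant times the height. Finally [|alpha| - |beta|] occurs for
    2, 2 and 8 tuples respectively, which divides the exponent [E] by 2, 2 and 8. *)

Require Import Defs.
From HB Require Import structures.
From mathcomp Require Import all_boot all_order all_algebra.
From mathcomp Require Import reals complex.
From mathcomp Require Import fingroup perm mpoly ring zify.

Set Implicit Arguments.
Unset Strict Implicit.
Unset Printing Implicit Defensive.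

Import Order.TTheory GRing.Theory Num.Theory.
Local Open Scope ring_scope.

(** * Integer elements of a ring *)

Definition int_valued (K : pzRingType) (z : K) : Prop := exists k : int, z = k%:~R.

Lemma int_valuedD (K : pzRingType) (y z : K) :
  int_valued y -> int_valued z -> int_valued (y + z).
Proof. by move=> [k ->] [l ->]; exists (k + l); rewrite rmorphD. Qed.

Lemma int_valuedM (K : pzRingType) (y z : K) :
  int_valued y -> int_valued z -> int_valued (y * z).
Proof. by move=> [k ->] [l ->]; exists (k * l); rewrite rmorphM. Qed.

Lemma int_valued_int (K : pzRingType) (k : int) : int_valued (k%:~R : K).
Proof. by exists k. Qed.

Lemma int_valuedX (K : pzRingType) (z : K) j : int_valued z -> int_valued (z ^+ j).
Proof. by move=> [k ->]; exists (k ^+ j); rewrite rmorphXn. Qed.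

Lemma int_valued_prod (K : pzRingType) (I : finType) (F : I -> K) :
  (forall i, int_valued (F i)) -> int_valued (\prod_i F i).
Proof.
move=> FZ; apply: (big_ind (@int_valued K)) => //; last exact: int_valuedM.
exact: (int_valued_int K 1).
Qed.

(** * Degree bounds in each variable *)

(** The degree is bounded in each variable separately, since this controls how many factors [a]
    integrality costs. The bound may vary with the variable, so that the bounds of factors add
    up. *)
Definition exp_le (n : nat) (S : nzRingType) (b : 'I_n -> nat)
    (p : {mpoly S[n]}) : Prop :=
  forall m, m \in msupp p -> forall i, (m i <= b i)%N.

Section ExpLe.
Context (n : nat) (S : nzRingType).
Implicit Types (b : 'I_n -> nat) (p q : {mpoly S[n]}).

Lemma exp_le_weaken b b' p :
  (forall i, (b i <= b' i)%N) -> exp_le b p -> exp_le b' p.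
Proof. by move=> bb' pb m mp i; apply: leq_trans (pb m mp i) (bb' i). Qed.

Lemma exp_leC b (c : S) : exp_le b c%:MP.
Proof.
move=> m; rewrite msuppC; case: eqP => // _; rewrite inE => /eqP -> i.
by rewrite mnm0E.
Qed.

Lemma exp_leX b (m : 'X_{1..n}) : (forall i, (m i <= b i)%N) -> exp_le b 'X_[S, m].
Proof. by move=> mb m'; rewrite msuppX inE => /eqP ->. Qed.

Lemma exp_leD b p q : exp_le b p -> exp_le b q -> exp_le b (p + q).
Proof.
by move=> pb qb m /msuppD_le; rewrite mem_cat => /orP[/pb|/qb].
Qed.

Lemma exp_leN b p : exp_le b p -> exp_le b (- p).
Proof. by move=> pb m; rewrite (perm_mem (msuppN p)) => /pb. Qed.

Lemma exp_leZ b c p : exp_le b p -> exp_le b (c *: p).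
Proof. by move=> pb m /msuppZ_le /pb. Qed.

Lemma exp_leM b b' p q :
  exp_le b p -> exp_le b' q -> exp_le (fun i => b i + b' i)%N (p * q).
Proof.
move=> pb qb m /msuppM_le /allpairsP[[m1 m2] /= [m1p m2q ->]] i.
by rewrite mnmDE leq_add ?pb ?qb.
Qed.

Lemma exp_le_sum b (J : Type) (r : seq J) (Q : pred J) (F : J -> {mpoly S[n]}) :
  (forall j, Q j -> exp_le b (F j)) -> exp_le b (\sum_(j <- r | Q j) F j).
Proof.
move=> Fb; apply: (big_ind (exp_le b)) => //; last exact: exp_leD.
by rewrite -mpolyC0; apply: exp_leC.
Qed.

Lemma exp_leXn b p j : exp_le b p -> exp_le (fun i => j * b i)%N (p ^+ j).
Proof.
move=> pb; elim: j => [|j IHj]; first by rewrite expr0 -mpolyC1; apply: exp_leC.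
by rewrite exprS; apply: exp_le_weaken (exp_leM pb IHj) => i; rewrite mulSn.
Qed.

Lemma exp_le_prod (J : Type) (r : seq J) (b : J -> 'I_n -> nat)
    (F : J -> {mpoly S[n]}) :
  (forall j, exp_le (b j) (F j)) ->
  exp_le (fun i => \sum_(j <- r) b j i)%N (\prod_(j <- r) F j).
Proof.
move=> Fb; elim: r => [|j r IHr].
  by rewrite big_nil -mpolyC1; apply: exp_leC.
rewrite big_cons; apply: exp_le_weaken (exp_leM (Fb j) IHr) => i.
by rewrite big_cons.
Qed.

Lemma exp_le_mesym j : exp_le (fun=> 1%N) (mesym n S j : {mpoly S[n]}).
Proof.
rewrite mesymE; apply: exp_le_sum => h _; apply: exp_leX => i.
by rewrite mnmE leq_b1.
Qed.

End ExpLe.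

(** * Integrality of symmetric polynomials in the roots *)

Section SymmetricValue.
Context (K : idomainType) (n : nat) (a : K) (x : 'I_n -> K).
Hypothesis aZ : int_valued a.
Hypothesis eZ : forall j : 'I_n, int_valued (a * mmap intr x (mesym n int j.+1)).

(** The sum telescopes; monotonicity makes the truncated subtractions exact. *)
Lemma sum_diff_le (c : nat -> nat) k :
  (forall i, c i.+1 <= c i)%N -> (\sum_(i < k) (c i - c i.+1) <= c 0)%N.
Proof.
move=> cm; suff: (\sum_(i < k) (c i - c i.+1) + c k = c 0)%N.
  by move=> <-; apply: leq_addr.
elim: k => [|k IHk]; first by rewrite big_ord0.
by rewrite big_ord_recr /= -addnA subnK.
Qed.

(* A degree-E version of the fundamental theorem: each step of the classical
   reduction subtracts a product of at most E elementary symmetric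
   polynomials, because its leading monomial is sorted. *)
Lemma symmetric_int_valued (E : nat) (p : {mpoly int[n]}) :
  p \is symmetric -> exp_le (fun=> E) p -> int_valued (a ^+ E * mmap intr x p).
Proof.
elim/mleadrect: p => p IHp sym_p pE.
have [->|p0] := eqVneq p 0.
  by rewrite mmap0 mulr0; apply: (int_valued_int K 0).
have /and3P[lt_p2 sym_p2 /eqP p_eq] := symf1P sym_p.
set p1 := (symf1 p).1 \mPo _ in p_eq.
(* Padding the leading exponents by 0 makes the last difference the last exponent itself. The
   elementary symmetric polynomials with exponents [F] then have the same leading monomial as
   [p]. *)
pose c := nth 0%N (mlead p); pose F := [multinom (c i - c i.+1)%N | i < n].
have p1E : p1 = p@_(mlead p) *: \prod_(i < n) (mesym n int i.+1) ^+ F i.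
  rewrite /p1 /symf1 (negPf p0) /= comp_mpolyZ comp_mpolyX; congr (_ *: _).
  by apply: eq_bigr => i _; rewrite tnth_mktuple.
have cm i : (c i.+1 <= c i)%N.
  have [lt_in|le_ni] := ltnP i.+1 n; last first.
    by rewrite /c nth_default // size_tuple.
  have := mlead_msym_sorted sym_p (i := Ordinal (ltnW lt_in)) (j := Ordinal lt_in).
  by rewrite !(mnm_nth 0%N) /=; apply.
(* The sum telescopes to at most the leading exponent of the first variable. *)
have sumF : (\sum_(i < n) F i <= E)%N.
  rewrite (eq_bigr (fun i : 'I_n => (c i - c i.+1)%N)); last by move=> i _; rewrite mnmE.
  apply: leq_trans (sum_diff_le n cm) _.
  rewrite /c; case: (posnP n) => [n0|n0].
    by rewrite nth_default // size_tuple n0.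
  by have := pE _ (mlead_supp p0) (Ordinal n0); rewrite (mnm_nth 0%N).
have p1b : exp_le (fun=> E) p1.
  rewrite p1E; apply: exp_leZ.
  have := @exp_le_prod n int _ (index_enum 'I_n) (fun i _ => F i * 1)%N _
    (fun i => exp_leXn (j := F i) (@exp_le_mesym n int i.+1)).
  apply: exp_le_weaken => _; apply: leq_trans sumF.
  by apply: leq_sum => i _; rewrite muln1.
have p2b : exp_le (fun=> E) (symf1 p).2.
  have -> : (symf1 p).2 = p - p1 by rewrite [in RHS]p_eq addrC addKr.
  exact: exp_leD pE (exp_leN p1b).
rewrite p_eq mmapD mulrDr; apply: int_valuedD; last first.
  case/orP: lt_p2 => [/eqP ->|lt_p2]; last exact: IHp.
  by rewrite mmap0 mulr0; apply: (int_valued_int K 0).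
rewrite p1E mmapZ mulrCA; apply: int_valuedM; first exact: int_valued_int.
(* Each elementary symmetric factor receives one [a]; the remaining power of [a] is an integer by
   itself. *)
rewrite -(subnK sumF) exprD -mulrA; apply: int_valuedM; first exact: int_valuedX.
rewrite -prodrXr rmorph_prod -big_split /=; apply: int_valued_prod => i.
by rewrite rmorphXn -exprMn; apply: int_valuedX; apply: eZ.
Qed.

End SymmetricValue.

(** * Counting tuples of distinct indices *)

Lemma card_uniq_tuple (T : finType) (k : nat) :
  #|[set u : k.-tuple T | uniq u]| = (#|T| ^_ k)%N.
Proof.
by rewrite -(card_uniq_tuples k predT); apply: eq_card => u; rewrite !inE all_predT.
Qed.

(** Transposing two indices in all entries shows that the count is the same for every [i]. The [d]
    classes partition the [d ^_ k] tuples, and [d ^_ k = d * d.-1 ^_ k.-1]. *)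
Lemma card_uniq_tuple_at (d k : nat) (j : 'I_k) (i : 'I_d) :
  #|[set u : k.-tuple 'I_d | uniq u & tnth u j == i]| = (d.-1 ^_ k.-1)%N.
Proof.
pose A i' := [set u : k.-tuple 'I_d | uniq u & tnth u j == i'].
have cardA i' : #|A i'| = #|A i|.
  pose f (u : k.-tuple 'I_d) := map_tuple (tperm i i') u.
  have f_inj : injective f.
    by move=> u v /(congr1 val) /= /(inj_map (@perm_inj _ _)) /val_inj.
  rewrite -(card_imset _ f_inj); congr #|pred_of_set _|.
  apply/setP=> v; apply/imsetP/idP => [[u]|].
    rewrite !inE => /andP[u_uniq /eqP uj] ->.
    by rewrite map_inj_uniq ?u_uniq ?tnth_map ?uj ?tpermR ?eqxx //; apply: perm_inj.
  rewrite !inE => /andP[v_uniq /eqP vj]; exists (f v).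
    by rewrite !inE map_inj_uniq ?v_uniq ?tnth_map ?vj ?tpermL ?eqxx //; apply: perm_inj.
  by apply: eq_from_tnth => l; rewrite !tnth_map tpermK.
have cardU : (\sum_(i' < d) #|A i'| = d ^_ k)%N.
  rewrite -[in RHS](card_ord d) -card_uniq_tuple -sum1_card.
  rewrite [RHS](partition_big (fun u => tnth u j) predT) //=.
  apply: eq_bigr => i' _; rewrite -sum1_card.
  by apply: eq_bigl => u; rewrite !inE.
rewrite (eq_bigr _ (fun i' _ => cardA i')) sum_nat_const card_ord in cardU.
rewrite -/(A i); move: #|A i| cardU => c {A cardA}.
case: k j => [[]//|k] _; case: d i => [[]//|d'] _.
by rewrite ffactSS => /eqP; rewrite eqn_pmul2l // => /eqP.
Qed.

(** * The polynomial with the forms as roots *)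

Section TupleForms.
Context (d k : nat) (m1 m2 : 'I_k -> nat) (e : int).

Let U := [set u : k.-tuple 'I_d | uniq u].
Let E := ((\sum_j (m1 j + m2 j)) * d.-1 ^_ k.-1)%N.

(** One shape for all three forms: [m1] and [m2] give exponents by position in the tuple, and [e]
    will be a sign. *)
Definition tuple_form (u : k.-tuple 'I_d) : {mpoly int[d]} :=
  \prod_j 'X_(tnth u j) ^+ m1 j + e *: \prod_j 'X_(tnth u j) ^+ m2 j.

Definition tuple_form_poly : {poly {mpoly int[d]}} :=
  \prod_(u in U) ('X - (tuple_form u)%:P).

Lemma msym_tuple_form (s : 'S_d) u :
  msym s (tuple_form u) = tuple_form (map_tuple s u).
Proof.
rewrite /tuple_form msymD msymZ !rmorph_prod; congr (_ + _ *: _);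
  apply: eq_bigr => j _; by rewrite rmorphXn /= /msym mmapX mmap1U tnth_map.
Qed.

(** Permuting the variables permutes the tuples of distinct indices, hence the linear factors. *)
Lemma tuple_form_poly_sym z : tuple_form_poly`_z \is symmetric.
Proof.
apply/issymP => s; rewrite -(coef_map (msym s)).
suff -> : map_poly (msym s) tuple_form_poly = tuple_form_poly by [].
pose f (u : k.-tuple 'I_d) := map_tuple s u.
have f_inj : injective f.
  by move=> u v /(congr1 val) /= /(inj_map (@perm_inj _ _)) /val_inj.
rewrite /tuple_form_poly rmorph_prod [in RHS](reindex_inj f_inj) /=.
apply: eq_big => [u|u _].
  by rewrite !inE map_inj_uniq //; apply: perm_inj.
by rewrite rmorphB /= map_polyX map_polyC /= msym_tuple_form.
Qed.

(** The sum of [m1] and [m2] equals their maximum in the forms used later, where no position has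
    both exponents positive. *)
Let b (u : k.-tuple 'I_d) i := (\sum_j (tnth u j == i) * (m1 j + m2 j))%N.

(** Each position holds [i] in exactly [d.-1 ^_ k.-1] of the tuples. *)
Lemma sum_tuple_exp i : (\sum_(u in U) b u i = E)%N.
Proof.
rewrite /b exchange_big /= /E big_distrl /=; apply: eq_bigr => j _.
rewrite -big_distrl /= mulnC; congr (_ * _)%N.
rewrite -(card_uniq_tuple_at j i) -sum1_card [RHS]big_mkcond [LHS]big_mkcond /=.
by apply: eq_bigr => u _; rewrite !inE; case: uniq; case: eqP.
Qed.

Lemma exp_le_tuple_form u : exp_le (b u) (tuple_form u).
Proof.
suff monE (m : 'I_k -> nat) : (forall j, m j <= m1 j + m2 j)%N ->
    exp_le (b u) (\prod_j 'X_(tnth u j) ^+ m j : {mpoly int[d]}).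
  apply: exp_leD; last apply: exp_leZ; apply: monE => j.
    exact: leq_addr.
  exact: leq_addl.
move=> m_le.
have := @exp_le_prod d int _ (index_enum 'I_k) _ _
  (fun j => exp_leXn (j := m j) (@exp_leX d int _ U_(tnth u j) (fun i => leqnn _))).
apply: exp_le_weaken => i; apply: leq_sum => j _.
by rewrite mnmE mulnC leq_mul.
Qed.

Lemma exp_le_tuple_form_poly z : exp_le (fun=> E) tuple_form_poly`_z.
Proof.
(* The induction runs over arbitrary lists of factors; only the full product over [U] has the
   uniform bound [E]. *)
suff coefE (r : seq (k.-tuple 'I_d)) : exp_le (fun i => \sum_(u <- r) b u i)%N
    (\prod_(u <- r) ('X - (tuple_form u)%:P))`_z.
  rewrite /tuple_form_poly -big_filter; apply: exp_le_weaken (coefE _) => i.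
  by rewrite big_filter sum_tuple_exp.
elim: r z => [|u r IHr] z.
  rewrite big_nil coef1 -mpolyC_nat; exact: exp_leC.
rewrite big_cons mulrBl coefB coefXM coefCM; apply: exp_leD.
  case: z => [|z] /=; first by rewrite -mpolyC0; apply: exp_leC.
  by apply: exp_le_weaken (IHr z) => i; rewrite big_cons leq_addl.
apply: exp_leN; apply: exp_le_weaken (exp_leM (@exp_le_tuple_form u) (IHr z)) => i.
by rewrite big_cons.
Qed.

End TupleForms.

Lemma norm_int_valued_ge1 (K : numDomainType) (z : K) :
  int_valued z -> z != 0 -> 1 <= `|z|.
Proof.
move=> [k ->]; rewrite intr_eq0 => k0.
by rewrite -intr_norm -[leLHS]/(1%:~R) ler_int -gtz0_ge1 normr_gt0.
Qed.

(** * Values of the forms at the roots *)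

Section RootForms.
Context (K : numFieldType) (d k : nat) (m1 m2 : 'I_k -> nat) (e : int).
Context (P : {poly int}) (x : d.-tuple K).
Hypothesis sizeP : size P = d.+1.
Hypothesis Px :
  map_poly intr P = (lead_coef P)%:~R *: \prod_(z <- x) ('X - z%:P).

Let U := [set u : k.-tuple 'I_d | uniq u].
Let E := ((\sum_j (m1 j + m2 j)) * d.-1 ^_ k.-1)%N.
Let a : K := (lead_coef P)%:~R.

Definition root_form (u : k.-tuple 'I_d) : K :=
  \prod_j tnth x (tnth u j) ^+ m1 j + e%:~R * \prod_j tnth x (tnth u j) ^+ m2 j.

Lemma mmap_tuple_form u : mmap intr (tnth x) (tuple_form m1 m2 e u) = root_form u.
Proof.
rewrite /tuple_form mmapD mmapZ !rmorph_prod; congr (_ + _ * _);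
  by apply: eq_bigr => j _; rewrite rmorphXn /= mmapX mmap1U.
Qed.

(** By Vieta this is, up to sign, a coefficient of [P]. *)
Lemma lead_mesym_int_valued (j : 'I_d) :
  int_valued (a * mmap intr (tnth x) (mesym d int j.+1)).
Proof.
have -> : mmap intr (tnth x) (mesym d int j.+1) = (mesym d K j.+1).@[tnth x].
  rewrite /mesym !raddf_sum /=; apply: eq_bigr => h _.
  rewrite !rmorph_prod; apply: eq_bigr => i _.
  by rewrite /= mmapX mmap1U mevalXU.
have lt_jd : (j.+1 < d.+1)%N by rewrite ltnS.
have /(congr1 (fun z => a * ((-1) ^+ j.+1 * z))) := mroots_coeff x (Ordinal lt_jd).
rewrite /= signrMK => <-.
rewrite mulrCA -coefZ -Px coef_map -[-1]/((-1)%:~R) -rmorphXn.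
by apply: int_valuedM; apply: int_valued_int.
Qed.

Lemma prod_nonzero_root_form_ge1 :
  1 <= `|a| ^+ E * \prod_(u in U | root_form u != 0) `|root_form u|.
Proof.
have a0 : a != 0 by rewrite intr_eq0 lead_coef_eq0 -size_poly_eq0 sizeP.
pose F := tuple_form_poly d m1 m2 e : {poly {mpoly int[d]}}.
(* The number of vanishing forms is the index of the lowest nonzero coefficient: they contribute
   ['X^z], and the constant term of the other factors remains. *)
pose z := #|[set u in U | root_form u == 0]|.
have Fz : mmap intr (tnth x) F`_z = \prod_(u in U | root_form u != 0) - root_form u.
  rewrite -(coef_map (mmap intr (tnth x))).
  have -> : map_poly (mmap intr (tnth x)) F = \prod_(u in U) ('X - (root_form u)%:P).
    rewrite /F /tuple_form_poly rmorph_prod; apply: eq_bigr => u _.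
    by rewrite rmorphB /= map_polyX map_polyC /= mmap_tuple_form.
  rewrite (bigID (fun u => root_form u == 0)) /=.
  rewrite (eq_bigr (fun=> 'X)) => [|u /andP[_ /eqP ->]]; last by rewrite subr0.
  have -> : \prod_(u in U | root_form u == 0) ('X : {poly K}) = 'X^z.
    rewrite prodr_const; congr (_ ^+ _); apply: eq_card => u.
    by rewrite [RHS]inE.
  rewrite coefXnM ltnn subnn -horner_coef0 horner_prod.
  by apply: eq_bigr => u _; rewrite hornerXsubC sub0r.
have : int_valued (a ^+ E * mmap intr (tnth x) F`_z).
  apply: symmetric_int_valued.
  - exact: int_valued_int.
  - exact: lead_mesym_int_valued.
  - exact: tuple_form_poly_sym.
  - exact: exp_le_tuple_form_poly.
rewrite Fz => /norm_int_valued_ge1 le1; apply: le_trans (le1 _) _.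
  rewrite mulf_neq0 ?expf_neq0 //.
  by apply/prodf_neq0 => u /andP[_]; rewrite oppr_eq0.
rewrite normrM normrX normr_prod le_eqVlt; apply/orP; left; apply/eqP.
by congr (_ * _); apply: eq_bigr => u _; rewrite normrN.
Qed.

Let w (u : k.-tuple 'I_d) : K := \prod_j (1 + `|tnth x (tnth u j)|) ^+ (m1 j + m2 j).

Lemma norm_root_form_le u : `|e| = 1 -> `|root_form u| <= 2 * w u.
Proof.
move=> e1; apply: le_trans (ler_normD _ _) _.
rewrite normrM -intr_norm e1 mul1r mulr_natl mulr2n !normr_prod.
have y1 j : 1 <= 1 + `|tnth x (tnth u j)| by rewrite lerDl.
have y2 j : `|tnth x (tnth u j)| <= 1 + `|tnth x (tnth u j)| by rewrite lerDr.
apply: lerD; apply: ler_prod => j _; rewrite normrX exprn_ge0 //=.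
  apply: le_trans (lerXn2r _ _ _ (y2 j)) _; rewrite ?nnegrE ?addr_ge0 //.
  by apply: ler_weXn2l => //; apply: leq_addr.
apply: le_trans (lerXn2r _ _ _ (y2 j)) _; rewrite ?nnegrE ?addr_ge0 //.
by apply: ler_weXn2l => //; apply: leq_addl.
Qed.

(** The count of [sum_tuple_exp] again: over all tuples, each root's weight has total exponent
    [E]. *)
Lemma prod_root_weight : \prod_(u in U) w u = (\prod_(z <- x) (1 + `|z|)) ^+ E.
Proof.
rewrite big_tuple -prodrXl.
have wE u : w u = \prod_i (1 + `|tnth x i|) ^+ (\sum_j (tnth u j == i) * (m1 j + m2 j)).
  under [RHS]eq_bigr do rewrite -prodrXr.
  rewrite exchange_big; apply: eq_bigr => j _.
  rewrite (bigD1 (tnth u j)) //= eqxx mul1n big1 ?mulr1 // => i.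
  by rewrite eq_sym => /negPf ->; rewrite mul0n expr0.
under eq_bigr do rewrite wE.
rewrite exchange_big; apply: eq_bigr => i _.
by rewrite prodrXr sum_tuple_exp.
Qed.

End RootForms.

(** * Bounding the roots by the height *)

(** The coefficients of [Q] are recovered from those of the product recursively, from the top if
    [|z| <= 1] and from the bottom if [1 <= |z|]. No step amplifies the previous bound, and each
    adds at most one [B]. *)
Lemma linear_factor_coef_le (K : numFieldType) (Q : {poly K}) (z B : K) (n : nat) :
  (size Q <= n)%N -> (forall i, `|(('X - z%:P) * Q)`_i| <= B) ->
  forall i, (1 + `|z|) * `|Q`_i| <= (2 * n)%:R * B.
Proof.
move=> szQ leB i; have B0 : 0 <= B := le_trans (normr_ge0 _) (leB 0%N).
have coefE j : (('X - z%:P) * Q)`_j = (if j is j'.+1 then Q`_j' else 0) - z * Q`_j.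
  by rewrite mulrBl coefB coefXM coefCM; case: j.
have Q0 j : (n <= j)%N -> Q`_j = 0 by move=> le_nj; rewrite nth_default ?(leq_trans szQ).
rewrite natrM -mulrA mulrDl mul1r mulr_natl [leRHS]mulr2n.
have /orP[z1|z1] := real_leVge (normr_real z) (@real1 K).
  have downward : forall l j, (n <= j + l)%N -> `|Q`_j| <= l%:R * B.
    elim=> [|l IHl] j; first by rewrite addn0 mul0r => /Q0 ->; rewrite normr0.
    rewrite addnS -addSn => /IHl Ql.
    have -> : Q`_j = (('X - z%:P) * Q)`_j.+1 + z * Q`_j.+1 by rewrite coefE subrK.
    apply: le_trans (ler_normD _ _) _.
    rewrite -[l.+1%:R]natr1 [leRHS]mulrDl mul1r addrC lerD //.
    rewrite normrM; apply: le_trans Ql; exact: ler_piMl.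
  have Qi := downward n i (leq_addl _ _).
  by rewrite lerD // (le_trans _ Qi) // ler_piMl.
have upward : forall j, `|z| * `|Q`_j| <= j.+1%:R * B.
  elim=> [|j IHj].
    by have := leB 0%N; rewrite coefE sub0r normrN normrM mulr1n mul1r.
  rewrite -normrM.
  have -> : z * Q`_j.+1 = Q`_j - (('X - z%:P) * Q)`_j.+1.
    by rewrite coefE opprB addrC subrK.
  apply: le_trans (ler_normB _ _) _; rewrite -[j.+2%:R]natr1 [leRHS]mulrDl mul1r lerD //.
  by apply: le_trans IHj; apply: ler_peMl.
have Qi : `|z| * `|Q`_i| <= n%:R * B.
  have [lt_in|/Q0 ->] := ltnP i n; last by rewrite normr0 mulr0 mulr_ge0.
  by apply: le_trans (upward i) _; rewrite ler_wpM2r // ler_nat.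
by rewrite lerD // (le_trans _ Qi) // ler_peMl.
Qed.

(* A weak form of Landau's inequality, in which the Mahler measure is replaced
   by the comparable quantity [|a| \prod (1 + |z|)]. *)
Lemma prod_root_le (K : numFieldType) (s : seq K) (a B : K) :
  (forall i, `|(a *: \prod_(z <- s) ('X - z%:P))`_i| <= B) ->
  `|a| * \prod_(z <- s) (1 + `|z|) <= (2 ^ size s * (size s)`!)%:R * B.
Proof.
elim: s a B => [|z s IHs] a B.
  by move=> /(_ 0%N); rewrite !big_nil alg_polyC coefC mulr1 mul1r.
rewrite !big_cons scalerAr => leB.
have z1 : 0 < 1 + `|z| by rewrite ltr_pwDl.
have szQ : (size (a *: \prod_(z <- s) ('X - z%:P)) <= (size s).+1)%N.
  by apply: leq_trans (size_scale_leq _ _) _; rewrite size_prod_XsubC.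
have /IHs : forall i, `|(a *: \prod_(z <- s) ('X - z%:P))`_i|
    <= (1 + `|z|)^-1 * ((2 * (size s).+1)%:R * B).
  by move=> i; rewrite ler_pdivlMl //; apply: linear_factor_coef_le szQ leB i.
rewrite [leRHS]mulrCA ler_pdivlMl // mulrCA => /le_trans; apply.
by rewrite mulrA -natrM mulnACA -expnSr [(_`! * _)%N]mulnC -factS.
Qed.

Lemma coef_le_height (K : numDomainType) (P : {poly int}) i :
  `|(map_poly intr P)`_i : K| <= (height P)%:R.
Proof.
rewrite coef_map /= -intr_norm -abszE; have [lt_i|le_i] := ltnP i (size P); last first.
  by rewrite nth_default // absz0 ler0n.
rewrite ler_nat.
exact: (@leq_bigmax _ (fun j : 'I_(size P) => `|(P`_j)%R|%N) (Ordinal lt_i)).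
Qed.

Lemma height_gt0 (P : {poly int}) : P != 0 -> (0 < height P)%N.
Proof.
move=> P0; have lt_i : ((size P).-1 < size P)%N by rewrite prednK ?lt0n ?size_poly_eq0.
apply: (@leq_trans `|lead_coef P|%N); first by rewrite absz_gt0 lead_coef_eq0.
exact: (@leq_bigmax _ (fun j : 'I_(size P) => `|(P`_j)%R|%N) (Ordinal lt_i)).
Qed.

(** * The general separation bound *)

(** The first factor collects a 2 from each form; the base of the second is the constant of
    [prod_root_le]. *)
Definition sep_const (d k E : nat) : nat := (2 ^ (d ^_ k) * (2 ^ d * d`!) ^ E)%N.

Lemma sep_const_gt0 d k E : (0 < sep_const d k E)%N.
Proof. by rewrite muln_gt0 !expn_gt0 muln_gt0 expn_gt0 fact_gt0. Qed.

(* Each [u] in [S] contributes a factor [delta] to a product of at least 1. *)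
Lemma root_form_separation (K : numFieldType) (d k : nat) (m1 m2 : 'I_k -> nat)
    (e : int) (P : {poly int}) (x : d.-tuple K) (E f : nat)
    (S : seq (k.-tuple 'I_d)) (delta : K) :
  size P = d.+1 ->
  map_poly intr P = (lead_coef P)%:~R *: \prod_(z <- x) ('X - z%:P) ->
  `|e| = 1 -> E = ((\sum_j (m1 j + m2 j)) * d.-1 ^_ k.-1)%N ->
  E = (size S * f)%N -> (0 < size S)%N -> uniq S -> 0 <= delta ->
  (forall u, u \in S -> [/\ uniq u, root_form m1 m2 e x u != 0 &
     `|root_form m1 m2 e x u| <=
        delta * (2 * \prod_j (1 + `|tnth x (tnth u j)|) ^+ (m1 j + m2 j))]) ->
  (sep_const d k E)%:R^-1 * (height P)%:R ^- f <= delta.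
Proof.
move=> sizeP Px e1 E_def E_S s0 uniqS delta0 SP.
pose U := [set u : k.-tuple 'I_d | uniq u].
pose T := root_form m1 m2 e x.
pose w (u : k.-tuple 'I_d) : K := \prod_j (1 + `|tnth x (tnth u j)|) ^+ (m1 j + m2 j).
pose H : K := (height P)%:R.
have P0 : P != 0 by rewrite -size_poly_eq0 sizeP.
have H0 : 0 < H by rewrite ltr0n height_gt0.
have w1 u : 1 <= 2 * w u.
  apply: mulr_ege1; first by rewrite ler1n.
  apply: (big_ind (fun z => 1 <= z)) => // [y z|j _]; first exact: mulr_ege1.
  by rewrite exprn_ege1 // lerDl.
(* Outside [S], nonzero forms are at most [2 * w u], and the omitted zero forms count as 1, also at
   most [2 * w u]. *)
have le_prod : \prod_(u in U | T u != 0) `|T u| <=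
    delta ^+ size S * \prod_(u in U) (2 * w u).
  have -> : delta ^+ size S = \prod_(u in U) (if u \in S then delta else 1).
    rewrite -big_mkcondr prodr_const -(card_uniqP uniqS); congr (_ ^+ _).
    apply: eq_card => u; rewrite [RHS]inE; have [/SP[uU _ _]|] := boolP (u \in S).
      by rewrite !inE uU.
    by rewrite andbF.
  rewrite big_mkcondr -big_split /=; apply: ler_prod => u _.
  have [uS|uS] := boolP (u \in S).
    by have [_ -> le_T] := SP u uS; rewrite normr_ge0.
  rewrite mul1r; case: ifP => _; last by rewrite ler01 w1.
  by rewrite normr_ge0 norm_root_form_le.
have Mahler : `|(lead_coef P)%:~R : K| * \prod_(z <- x) (1 + `|z|) <=
    (2 ^ d * d`!)%:R * H.
  have := @prod_root_le K x (lead_coef P)%:~R H; rewrite size_tuple; apply=> i.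
  by rewrite -Px coef_le_height.
have cardU : #|U| = (d ^_ k)%N by rewrite card_uniq_tuple card_ord.
have key : 1 <= delta ^+ size S * ((sep_const d k E)%:R * H ^+ E).
  apply: le_trans (prod_nonzero_root_form_ge1 m1 m2 e sizeP Px) _; rewrite -E_def.
  apply: le_trans (ler_wpM2l (exprn_ge0 _ (normr_ge0 _)) le_prod) _.
  rewrite big_split prodr_const cardU /= prod_root_weight -E_def.
  rewrite mulrCA; apply: ler_wpM2l; first exact: exprn_ge0.
  rewrite mulrCA -exprMn natrM natrX -mulrA; apply: ler_wpM2l; first exact: exprn_ge0.
  rewrite natrX -exprMn; apply: lerXn2r => //; rewrite nnegrE.
    by rewrite mulr_ge0 // prodr_ge0 // => z _; rewrite addr_ge0.
  by rewrite mulr_ge0 // ltW.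
have N0 : 0 < (sep_const d k E)%:R :> K by rewrite ltr0n sep_const_gt0.
(* Powers of order [size S] are compared. The constant is at least 1, so raising its inverse to that
   power only decreases it. *)
rewrite -(@ler_pXn2r _ (size S)) ?nnegrE ?mulr_ge0 ?invr_ge0 ?ler0n ?exprn_ge0 //.
rewrite exprMn !exprVn -exprM -[(f * _)%N]mulnC -E_S.
apply: (@le_trans _ _ ((sep_const d k E)%:R^-1 * H ^- E)).
  rewrite ler_pM2r ?invr_gt0 ?exprn_gt0 // lef_pV2 ?posrE ?exprn_gt0 //.
  by rewrite -natrX ler_nat -{1}[sep_const _ _ _]expn1 leq_pexp2l ?sep_const_gt0.
by rewrite -invfM -[leLHS]mul1r ler_pdivrMr // mulr_gt0 ?exprn_gt0.
Qed.

(** * The three cases of real and nonreal roots *)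

Section Separation.
Context (K : numClosedFieldType) (d : nat) (P : {poly int}).
Hypothesis sizeP : size P = d.+1.

Lemma root_tuple_exists : {x : d.-tuple K |
    map_poly intr P = (lead_coef P)%:~R *: \prod_(z <- x) ('X - z%:P)}.
Proof.
have [r rE] := closed_field_poly_normal (map_poly intr P : {poly K}).
have leadE : lead_coef (map_poly intr P : {poly K}) = (lead_coef P)%:~R.
  by rewrite lead_coef_map_inj //; apply: intr_inj.
have size_r : size r == d.
  have := congr1 (fun p : {poly K} => size p) rE.
  rewrite size_map_inj_poly ?rmorph0 //; last exact: intr_inj.
  rewrite sizeP size_scale ?size_prod_XsubC; first by case=> ->.
  by rewrite leadE intr_eq0 lead_coef_eq0 -size_poly_eq0 sizeP.
by exists (Tuple size_r); rewrite -leadE.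
Qed.

Context (x : d.-tuple K).
Hypothesis Px :
  map_poly intr P = (lead_coef P)%:~R *: \prod_(z <- x) ('X - z%:P).

Lemma root_index (z : K) : root (map_poly intr P) z -> exists i, z = tnth x i.
Proof.
have a0 : (lead_coef P)%:~R != 0 :> K.
  by rewrite intr_eq0 lead_coef_eq0 -size_poly_eq0 sizeP.
by rewrite Px rootZ // root_prod_XsubC => /tnthP.
Qed.

Lemma root_conj (z : K) :
  root (map_poly intr P) z -> root (map_poly intr P) z^*.
Proof.
rewrite -(fmorph_root Num.conj) -map_poly_comp /=.
by congr (root _ _); apply: eq_map_poly => c /=; rewrite rmorph_int.
Qed.

Let delta (y z : K) := `| `|y| - `|z| |.

Lemma norm_sqr_sub (y z : K) :
  `| `|y| ^+ 2 - `|z| ^+ 2| = delta y z * (`|y| + `|z|).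
Proof. by rewrite subr_sqr normrM [X in _ * X = _]ger0_norm // addr_ge0. Qed.

(** Absorbs the cofactor in [norm_sqr_sub] into the weight allowed by [root_form_separation]. *)
Lemma norm_sum_le (y z : K) :
  `|y| + `|z| <= 2 * ((1 + `|y|) ^+ 2 * (1 + `|z|) ^+ 2).
Proof.
have le1 (t : K) : 1 <= (1 + `|t|) ^+ 2 by rewrite exprn_ege1 // lerDl.
have le_t (t : K) : `|t| <= (1 + `|t|) ^+ 2.
  by rewrite (@le_trans _ _ (1 + `|t|)) ?lerDr // ler_eXnr // lerDl.
rewrite mulr_natl mulr2n lerD //.
  by apply: le_trans (le_t y) _; rewrite ler_peMr // (le_trans ler01).
by apply: le_trans (le_t z) _; rewrite ler_peMl // (le_trans ler01).
Qed.

(** [e] is [-1] for equal signs and [1] for opposite ones, with 0 counted as positive. *)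
Lemma real_norm_sub (y z : K) : y \is Num.real -> z \is Num.real ->
  exists e : int, `|e| = 1 /\ `|y + e%:~R * z| = delta y z.
Proof.
rewrite /delta => /real_ge0P[y0|y0] /real_ge0P[z0|z0].
- by exists (-1); split; rewrite // mulN1r.
- by exists 1; split; rewrite // mul1r opprK.
- by exists 1; split; rewrite // mul1r -normrN opprD.
- by exists (-1); split; rewrite // mulN1r -normrN opprD.
Qed.

Lemma separation_real_real (y z : K) :
  root (map_poly intr P) y -> root (map_poly intr P) z -> `|y| != `|z| ->
  y \is Num.real -> z \is Num.real ->
  (sep_const d 2 (2 * (d - 1)))%:R^-1 * (height P)%:R ^- (d - 1) <= delta y z.
Proof.
move=> /root_index[i ->] /root_index[j ->] yz yR zR.
have [e [e1 eE]] := real_norm_sub yR zR.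
have eV : e%:~R * e%:~R = 1 :> K.
  by rewrite -rmorphM /= -expr2 -real_normK ?num_real // e1.
pose m1 (l : 'I_2) := nth 0%N [:: 1; 0]%N l.
pose m2 (l : 'I_2) := nth 0%N [:: 0; 1]%N l.
have rfE (i1 i2 : 'I_d) : root_form m1 m2 e x [tuple i1; i2] =
    tnth x i1 + e%:~R * tnth x i2.
  rewrite /root_form /m1 /m2 !big_ord_recl !big_ord0 !(tnth_nth i) /=.
  by rewrite !expr1 !expr0; ring.
have ij : i != j by apply: contra_neq yz => ->.
apply: (root_form_separation (m1 := m1) (m2 := m2)
  (S := [:: [tuple i; j]; [tuple j; i]]) sizeP Px e1) => //.
- by rewrite /m1 /m2 !big_ord_recl big_ord0 /= ffactn1 subn1.
- by rewrite /= inE -val_eqE /= !eqseq_cons (negPf ij).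
- exact: normr_ge0.
have delta0 : delta (tnth x i) (tnth x j) != 0 by rewrite normr_eq0 subr_eq0.
have boundE (i1 i2 : 'I_d) : i1 != i2 ->
    `|tnth x i1 + e%:~R * tnth x i2| = delta (tnth x i) (tnth x j) ->
    let u := [tuple i1; i2] in
    [/\ uniq u, root_form m1 m2 e x u != 0 &
     `|root_form m1 m2 e x u| <=
      delta (tnth x i) (tnth x j) * (2 * \prod_j0 (1 + `|tnth x (tnth u j0)|) ^+
         (m1 j0 + m2 j0))].
  move=> i12 nE; split; first by rewrite /= inE i12.
    by rewrite rfE -normr_eq0 nE.
  rewrite rfE nE; apply: ler_peMr; first exact: normr_ge0.
  apply: mulr_ege1; first by rewrite ler1n.
  apply: (big_ind (fun z => 1 <= z)) => // [*|j0 _]; first exact: mulr_ege1.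
  by rewrite exprn_ege1 // lerDl.
move=> u; rewrite !inE => /orP[] /eqP ->; apply: boundE => //; first by rewrite eq_sym.
(* Swapping the indices multiplies the form by [e], because [e] squares to 1. *)
have -> : tnth x j + e%:~R * tnth x i = e%:~R * (tnth x i + e%:~R * tnth x j).
  by rewrite mulrDr mulrA eV mul1r addrC.
by rewrite normrM -intr_norm e1 mul1r.
Qed.

Lemma separation_real_nonreal (y z : K) :
  root (map_poly intr P) y -> root (map_poly intr P) z -> `|y| != `|z| ->
  y \is Num.real -> z \isn't Num.real ->
  (sep_const d 3 (4 * ((d - 1) * (d - 2))))%:R^-1 *
    (height P)%:R ^- (2 * (d - 1) * (d - 2)) <= delta y z.
Proof.
move=> /root_index[i ->] zP yz yR zR.
have /root_index[l zlE] := root_conj zP.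
move: zP yz zR zlE => /root_index[j ->] yz zR zlE.
have sqE : `|tnth x i| ^+ 2 - `|tnth x j| ^+ 2 = tnth x i ^+ 2 - tnth x j * tnth x l.
  by rewrite real_normK // normCK zlE.
have norm_l : `|tnth x l| = `|tnth x j| by rewrite -zlE norm_conjC.
(* The moduli separate [i] from the conjugate pair; nonreality separates the pair. *)
have ij : i != j by apply: contra_neq yz => ->.
have il : i != l by apply: contra_neq yz => ->.
have jl : j != l.
  by apply: contraNneq zR => jl; rewrite CrealE zlE -jl.
pose m1 (t : 'I_3) := nth 0%N [:: 2; 0; 0]%N t.
pose m2 (t : 'I_3) := nth 0%N [:: 0; 1; 1]%N t.
(* Exchanging the two conjugates preserves the form, so two tuples share the exponent [E]. *)
apply: (root_form_separation (m1 := m1) (m2 := m2) (e := -1)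
  (S := [:: [tuple i; j; l]; [tuple i; l; j]]) sizeP Px) => //.
- by rewrite /m1 /m2 !big_ord_recl big_ord0 /= ffactnSr ffactn1; congr (_ * _)%N; lia.
- by rewrite /=; lia.
- by rewrite /= inE -val_eqE /= !eqseq_cons (negPf jl) andbF.
- exact: normr_ge0.
suff boundE (j1 j2 : 'I_d) : tnth x j1 * tnth x j2 = tnth x j * tnth x l ->
    `|tnth x j1| = `|tnth x j| -> `|tnth x j2| = `|tnth x j| ->
    uniq [:: i; j1; j2] ->
    let u := [tuple i; j1; j2] in
    let rf := root_form m1 m2 (-1) x u in
    [/\ uniq u, rf != 0 & `|rf| <= delta (tnth x i) (tnth x j) *
       (2 * \prod_t (1 + `|tnth x (tnth u t)|) ^+
         (m1 t + m2 t))].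
  move=> u; rewrite !inE => /orP[] /eqP ->; apply: boundE => //.
  - by rewrite /= !inE !negb_or ij il jl.
  - by rewrite mulrC.
  - by rewrite /= !inE !negb_or ij il eq_sym jl.
move=> prodE n1 n2 uniq_u u rf.
have rfE : rf = `|tnth x i| ^+ 2 - `|tnth x j| ^+ 2.
  rewrite sqE -prodE /rf /root_form /m1 /m2 !big_ord_recl !big_ord0 !(tnth_nth i) /=.
  by rewrite !expr1 !expr0 rmorphN1; ring.
split=> //; first by rewrite rfE subr_eq0 eqrXn2.
rewrite rfE norm_sqr_sub; apply: ler_wpM2l; first exact: normr_ge0.
rewrite /m1 /m2 !big_ord_recl !big_ord0 !(tnth_nth i) /= n1 n2 !expr1 mulr1.
exact: norm_sum_le.
Qed.

Lemma separation_nonreal (y z : K) :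
  root (map_poly intr P) y -> root (map_poly intr P) z -> `|y| != `|z| ->
  y \isn't Num.real -> z \isn't Num.real ->
  (sep_const d 4 (4 * ((d - 1) * (d - 2) * (d - 3))))%:R^-1 *
    (height P)%:R ^- (((d - 1) * (d - 2) * (d - 3)) %/ 2) <= delta y z.
Proof.
move=> yP zP yz yR zR.
have /root_index[i' yE] := root_conj yP; have /root_index[j' zE] := root_conj zP.
move: yP zP yz yR yE zR zE => /root_index[i ->] /root_index[j ->] yz yR yE zR zE.
have sqE : `|tnth x i| ^+ 2 - `|tnth x j| ^+ 2 =
    tnth x i * tnth x i' - tnth x j * tnth x j' by rewrite !normCK yE zE.
have norm_i' : `|tnth x i'| = `|tnth x i| by rewrite -yE norm_conjC.
have norm_j' : `|tnth x j'| = `|tnth x j| by rewrite -zE norm_conjC.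
have ij : i != j by apply: contra_neq yz => ->.
have ij' : i != j' by apply: contra_neq yz => ->.
have i'j : i' != j by apply: contra_neq yz => <-.
have i'j' : i' != j' by apply: contra_neq yz => E; rewrite -norm_i' E.
have ii' : i != i' by apply: contraNneq yR => E; rewrite CrealE yE -E.
have jj' : j != j' by apply: contraNneq zR => E; rewrite CrealE zE -E.
pose m1 (t : 'I_4) := nth 0%N [:: 1; 1; 0; 0]%N t.
pose m2 (t : 'I_4) := nth 0%N [:: 0; 0; 1; 1]%N t.
(* Swaps inside either conjugate pair preserve the form and exchanging the pairs changes its sign:
   eight tuples. *)
apply: (root_form_separation (m1 := m1) (m2 := m2) (e := -1)
  (S := [:: [tuple i; i'; j; j']; [tuple i'; i; j; j'];
            [tuple i; i'; j'; j]; [tuple i'; i; j'; j];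
            [tuple j; j'; i; i']; [tuple j; j'; i'; i];
            [tuple j'; j; i; i']; [tuple j'; j; i'; i]]) sizeP Px) => //.
- rewrite /m1 /m2 !big_ord_recl big_ord0 /= !ffactnSr ffactn0; congr (_ * _)%N.
  by rewrite mul1n subn0 -!subn1 -!subnDA.
(* Divisibility by 6 makes the halving in the exponent exact. *)
- have -> : ((d - 1) * (d - 2) * (d - 3) = 'C(d - 1, 3) * 6)%N.
    by rewrite bin_ffact !ffactnSr ffactn0 mul1n subn0 -!subnDA.
  by rewrite (mulnA _ 3 2) mulnK //= mulnA mulnC; lia.
- by rewrite /= !inE -!val_eqE /= !eqseq_cons (negPf ij) (negPf ij') (negPf i'j)
    (negPf i'j') (negPf ii') (negPf jj') (eq_sym i' i) (eq_sym j' j) (negPf ii')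
    (negPf jj') !andbF.
- exact: normr_ge0.
(* The eight cases share one argument, which uses only the value up to sign and the weight. *)
suff boundE (i1 i2 j1 j2 : 'I_d) :
    (let V := tnth x i1 * tnth x i2 - tnth x j1 * tnth x j2 in
     let V0 := tnth x i * tnth x i' - tnth x j * tnth x j' in V = V0 \/ V = - V0) ->
    (1 + `|tnth x i1|) * (1 + `|tnth x i2|) * (1 + `|tnth x j1|) * (1 + `|tnth x j2|)
      = (1 + `|tnth x i|) ^+ 2 * (1 + `|tnth x j|) ^+ 2 ->
    uniq [:: i1; i2; j1; j2] ->
    let u := [tuple i1; i2; j1; j2] in
    let rf := root_form m1 m2 (-1) x u in
    [/\ uniq u, rf != 0 & `|rf| <= delta (tnth x i) (tnth x j) *
       (2 * \prod_t (1 + `|tnth x (tnth u t)|) ^+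
         (m1 t + m2 t))].
  move=> u; rewrite !inE.
  do 7?[case/orP]; move/eqP=> ->; apply: boundE => /=;
    rewrite ?norm_i' ?norm_j'; try (by [left; ring | right; ring | ring]);
  by rewrite !inE !negb_or; repeat (apply/andP; split); rewrite // eq_sym.
move=> VE wE uniq_u u rf.
have rfE : `|rf| = `| `|tnth x i| ^+ 2 - `|tnth x j| ^+ 2|.
  have -> : rf = tnth x i1 * tnth x i2 - tnth x j1 * tnth x j2.
    rewrite /rf /root_form /m1 /m2 !big_ord_recl !big_ord0 !(tnth_nth i) /=.
    by rewrite !expr1 !expr0 rmorphN1; ring.
  by rewrite sqE; case: VE => ->; rewrite ?normrN.
split=> //; first by rewrite -normr_eq0 rfE normr_eq0 subr_eq0 eqrXn2.
rewrite rfE norm_sqr_sub; apply: ler_wpM2l; first exact: normr_ge0.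
rewrite /m1 /m2 !big_ord_recl !big_ord0 !(tnth_nth i) /= !expr1 mulr1.
by apply: le_trans (norm_sum_le _ _) _; rewrite -wE !mulrA.
Qed.

End Separation.

(** * Conclusion over the complex numbers *)

Theorem theorem1 (R : realType) (d : nat) (d_ge1 : (1 <= d)%N) :
  exists2 c : R, 0 < c &
    forall (P : {poly int}) (alpha beta : R[i]),
      size P = d.+1 ->
      root (map_poly intr P) alpha ->
      root (map_poly intr P) beta ->
      Normc.normc alpha != Normc.normc beta ->
      [/\ alpha \is Num.real -> beta \is Num.real ->
            c * (height P)%:R ^- (d - 1) <= `|Normc.normc alpha - Normc.normc beta|,
          alpha \is Num.real -> beta \isn't Num.real ->
            c * (height P)%:R ^- (2 * (d - 1) * (d - 2))
              <= `|Normc.normc alpha - Normc.normc beta|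
        & alpha \isn't Num.real -> beta \isn't Num.real ->
            c * (height P)%:R ^- (((d - 1) * (d - 2) * (d - 3)) %/ 2)
              <= `|Normc.normc alpha - Normc.normc beta| ].
Proof.
(* The sum of the three constants dominates each, so its inverse serves all cases. *)
pose N2 := sep_const d 2 (2 * (d - 1)).
pose N3 := sep_const d 3 (4 * ((d - 1) * (d - 2))).
pose N4 := sep_const d 4 (4 * ((d - 1) * (d - 2) * (d - 3))).
have N0 : (0 < N2 + N3 + N4)%N by rewrite addn_gt0 sep_const_gt0 orbT.
exists (N2 + N3 + N4)%:R^-1; first by rewrite invr_gt0 ltr0n.
move=> P y z sizeP yP zP yz.
(* The norm on [R[i]] takes values in [R[i]]; this brings the bounds back to [R]. *)
have transfer (N f : nat) : (0 < N <= N2 + N3 + N4)%N ->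
    N%:R^-1 * (height P)%:R ^- f <= `| `|y| - `|z| | ->
    (N2 + N3 + N4)%:R^-1 * (height P)%:R ^- f
      <= `|Normc.normc y - Normc.normc z|.
  move=> /andP[Npos leN].
  have -> : `| `|y| - `|z| | = (`|Normc.normc y - Normc.normc z|)%:C%C.
    by rewrite -[`|y|]/((Normc.normc y)%:C%C) -[`|z|]/((Normc.normc z)%:C%C)
      -rmorphB /= normc_def /= expr0n addr0 sqrtr_sqr.
  have -> : (N%:R^-1 * (height P)%:R ^- f : R[i]) =
      (N%:R^-1 * (height P)%:R ^- f)%:C%C.
    by rewrite rmorphM !fmorphV rmorphXn !rmorph_nat.
  rewrite lecR; apply: le_trans; apply: ler_wpM2r.
    by rewrite invr_ge0 exprn_ge0.
  by rewrite lef_pV2 ?posrE ?ltr0n // ler_nat.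
have [x Px] := root_tuple_exists R[i] sizeP.
have norm_yz : `|y| != `|z|.
  by apply: contra_neq yz => /(congr1 (@complex.Re R)).
split=> yR zR.
- apply: (transfer N2); first by rewrite sep_const_gt0 -addnA leq_addr.
  exact: (separation_real_real sizeP Px).
- apply: (transfer N3); first by rewrite sep_const_gt0 addnAC leq_addl.
  exact: (separation_real_nonreal sizeP Px).
- apply: (transfer N4); first by rewrite sep_const_gt0 leq_addl.
  exact: (separation_nonreal sizeP Px).
Qed.
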